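(* Let $\mu$ be a (non-zero) finite Borel measure on $\mathbb{R}^d$ and $\theta\in(0,1]$. Then \[ \dim_{\mathrm F}^{\theta}\mu\geq\underline{F}_\mu(\theta). \]
   Context: For a finite Borel measure $\mu$ on $\mathbb{R}^d$ write $\widehat\mu(z)=\int e^{-2\pi i z\cdot x}\,d\mu(x)$. For $s\geq 0$ and $\theta\in(0,1]$ let $\mathcal{J}_{s,\theta}(\mu)=\left(\int_{\mathbb{R}^d}|\widehat\mu(z)|^{2/\theta}|z|^{s/\theta-d}\,dz\right)^{\theta}$. The Fourier spectrum of $\mu$ at $\theta$ is $\dim_{\mathrm F}^{\theta}\mu=\sup\{s\geq 0:\mathcal{J}_{s,\theta}(\mu)<\infty\}\in[0,\infty]$, with $\sup\emptyset=0$. For $\theta\in(0,1]$, \[ \underline{F}_\mu(\theta)=\liminf_{R\to\infty}\frac{\theta\log\left(R^{-d}\int_{|z|\leq R}|\widehat\mu(z)|^{2/\theta}\,dz\right)}{-\log R}. \] *)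

(* Defs.v *)
From HB Require Import structures.
From mathcomp Require Import all_boot all_order all_algebra.
From mathcomp Require Import all_classical all_reals all_analysis.
From mathcomp Require Import complex.

Set Implicit Arguments.
Unset Strict Implicit.
Unset Printing Implicit Defensive.

Import Order.TTheory GRing.Theory Num.Theory.
Import numFieldNormedType.Exports.

Local Open Scope classical_set_scope.
Local Open Scope ring_scope.

(* R^d. Its sigma-algebra is generated by the coordinate projections to R with
   its Borel sets, so it is the Borel sigma-algebra of R^d. *)
Notation euclid R d := (d.-tuple (measurableTypeR R)).

Section lebesgue.
Variable R : realType.

Definition euclid_cons d (p : measurableTypeR R * euclid R d) : euclid R d.+1 :=
  [tuple of p.1 :: p.2].

Lemma measurable_euclid_cons d : measurable_fun [set: _] (@euclid_cons d).
Proof. exact: (measurable_cons measurable_fst measurable_snd). Qed.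

Section step.
Variables (d : nat) (mu : {sigma_finite_measure set (euclid R d) -> \bar R}).

Definition lebesgue_step : set (euclid R d.+1) -> \bar R :=
  pushforward (@lebesgue_measure R \x mu)%E (@euclid_cons d).

HB.instance Definition _ := Measure.copy lebesgue_step
  (measure_function_pushforward__canonical__measure_function_Measure
    (@lebesgue_measure R \x mu)%E (@measurable_euclid_cons d)).

Let lebesgue_step_sigma_finite : sigma_finite setT lebesgue_step.
Proof.
have /sigma_finiteP[F [TF ndF Foo]] := sigma_finiteT (@lebesgue_measure R).
have /sigma_finiteP[G [TG ndG Goo]] := sigma_finiteT mu.
exists (fun n => (fun x : euclid R d.+1 => (thead x, [tuple of behead x]))
                   @^-1` (F n `*` G n)).
  apply/seteqP; split => // x _.
  have : [set: _] (thead x) by [].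
  rewrite TF => -[n _ Fn].
  have : [set: _] [tuple of behead x] by [].
  rewrite TG => -[k _ Gk].
  exists (maxn n k) => //; split => /=.
  - by move: Fn; exact/subsetPset/ndF/leq_maxl.
  - by move: Gk; exact/subsetPset/ndG/leq_maxr.
move=> i; have [? ?] := Foo i; have [? ?] := Goo i; split.
  rewrite -[X in measurable X]setTI.
  apply: (measurable_fun_pair (@measurable_tnth _ _ _ ord0)
                              (@measurable_behead _ _ _)) => //.
  exact: measurableX.
rewrite /lebesgue_step /pushforward.
suff -> : @euclid_cons d @^-1`
    ((fun x : euclid R d.+1 => (thead x, [tuple of behead x]))
       @^-1` (F i `*` G i)) = F i `*` G i.
  by rewrite product_measure1E// lte_mul_pinfty// ge0_fin_numE.
apply/funext => -[x y]; rewrite /preimage/= theadE.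
rewrite (_ : [tuple of behead [tuple of x :: y]] = y)//; exact/val_inj.
Qed.

HB.instance Definition _ := Measure_isSigmaFinite.Build _ _ _
  lebesgue_step lebesgue_step_sigma_finite.
End step.

(* The product of d copies of the Lebesgue measure of R. *)
Fixpoint lebesgue d : {sigma_finite_measure set (euclid R d) -> \bar R} :=
  if d is d'.+1 then lebesgue_step (lebesgue d') else \d_([tuple]).

Lemma lebesgue_box d (A : 'I_d -> set (measurableTypeR R)) :
  (forall i, measurable (A i)) ->
  lebesgue d [set x | forall i, A i (tnth x i)] =
  (\prod_(i < d) lebesgue_measure (A i))%E.
Proof.
elim: d A => [|d ih] A mA.
  rewrite big_ord0 /= diracE mem_set//; by case.
rewrite big_ord_recl /= /lebesgue_step /pushforward.
pose B i := A (lift ord0 i).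
rewrite -(ih B) => [|i]; last exact: mA.
rewrite -product_measure1E//; last first.
  rewrite (_ : [set x | _] = \bigcap_(i in [set: 'I_d])
      ((@tnth _ (measurableTypeR R) ^~ i) @^-1` B i)).
    apply: fin_bigcap_measurable => // i _; rewrite -[X in measurable X]setTI.
    by apply: measurable_tnth => //; exact: mA.
  by apply/seteqP; split=> x /= Bx i => [_|]; exact: Bx.
congr (product_measure1 _ _ _); apply/seteqP; split => -[x y] /=.
  move=> Axy; split=> [|i]; first exact: (Axy ord0).
  by have := Axy (lift ord0 i); rewrite tnthS.
move=> [Ax By] i; case: (unliftP ord0 i) => [j ->|->]; last exact: Ax.
by rewrite tnthS; exact: By.
Qed.
End lebesgue.

Section fourier_spectrum.
Variables (R : realType) (d : nat).
Implicit Types (x z : euclid R d) (mu : {finite_measure set (euclid R d) -> \bar R}).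

Definition dot z x : R := \sum_(i < d) (tnth z i : R) * (tnth x i : R).

(* The Euclidean norm. *)
Definition enorm z : R := Num.sqrt (dot z z).

(* e^{it} *)
Definition expi (t : R) : R[i] := (cos t +i* sin t)%C.

Definition cintegral mu (f : euclid R d -> R[i]) : R[i] :=
  (\int[mu]_x complex.Re (f x) +i* \int[mu]_x complex.Im (f x))%C.

Definition fourier mu z : R[i] :=
  cintegral mu (fun x => expi (- (2 * pi * dot z x))).

Definition fourier_norm mu z : R := Normc.normc (fourier mu z).

(* The integrand takes the value given by 0 `^ a at z = 0, a null set when
   0 < d, so that the convention for 0 `^ a is immaterial there. *)
Definition energy mu (s theta : R) : \bar R :=
  ((\int[lebesgue R d]_z
      (fourier_norm mu z `^ (2 / theta) * enorm z `^ (s / theta - d%:R))%:E)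
   `^ theta)%E.

(* The maximum with 0 encodes that the supremum of the empty set is 0; it
   changes nothing otherwise. *)
Definition fourier_dim mu (theta : R) : \bar R :=
  Order.max 0%E (ereal_sup
    [set s%:E | s in [set s : R | 0 <= s /\ (energy mu s theta < +oo)%E]]).

Definition lower_F mu (theta : R) : \bar R :=
  limf_einf (fun r : R =>
    theta%:E *
      lne ((r ^- d)%:E *
           \int[lebesgue R d]_(z in [set z | (enorm z <= r)%R])
             (fourier_norm mu z `^ (2 / theta))%:E)
    / (- ln r)%:E)%E (pinfty_nbhs R).

End fourier_spectrum.

(* Main.v *)
(* If s < t < lower_F, the definition of the lower limit gives
   I(r) <= M r^(d - t/theta) for r >= 1, where I(r) is the integral of
   |fourier mu|^(2/theta) over the ball of radius r; boundedness of the Fourier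
   transform gives I(r) <= C r^d for all r.  On a dyadic shell |z| ~ r the
   energy integrand is comparable to r^(s/theta - d) |fourier mu|^(2/theta), so
   the shell contributes O(r^((s - t)/theta)) for r = 2^n and O(r^(s/theta)) for
   r = 2^-n.  Both are summable geometric series when 0 < s < t. *)
Require Import Defs.
From mathcomp Require Import all_boot all_order all_algebra.
From mathcomp Require Import all_classical all_reals all_analysis.
From mathcomp Require Import measurable_realfun complex ring lra.

Set Implicit Arguments.
Unset Strict Implicit.
Unset Printing Implicit Defensive.

Import Order.TTheory GRing.Theory Num.Theory.
Import numFieldNormedType.Exports.

Local Open Scope classical_set_scope.
Local Open Scope ring_scope.

(** * Real powers and dyadic scales *)

Section real_powers.
Variable R : realType.
Implicit Types (a c r t x y : R).

Lemma powR_lt1 r a : 0 < r -> a * ln r < 0 -> r `^ a < 1.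
Proof. by move=> r0 ar0; rewrite /powR gt_eqF// expR_lt1. Qed.

Lemma powRXC r n a : 0 <= r -> (r ^+ n) `^ a = (r `^ a) ^+ n.
Proof.
by move=> r0; rewrite -!powR_mulrn ?powR_ge0// -!powRrM mulrC.
Qed.

Lemma dyadic_shell y : 1 <= y -> exists n, 2 ^+ n <= y <= 2 ^+ n.+1.
Proof.
move=> y1.
(* The least such [n] works: minimality gives [2 ^+ n <= y] when [n > 0], and [1 <= y] gives it when
   [n = 0]. *)
have [|n ny nmin] := @ex_minnP (fun n => y <= 2 ^+ n.+1).
  exists (Num.trunc y); apply: ltW; apply: (lt_trans (Num.Theory.truncnS_gt y)).
  by rewrite -natrX ltr_nat ltn_expl.
exists n; rewrite ny andbT.
case: n ny nmin => [|n] _ nmin; first by rewrite expr0.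
by rewrite leNgt; apply/negP => /ltW /nmin; rewrite ltnn.
Qed.

(** For [0 <= a] the power is nondecreasing and [x <= t] suffices; for [a < 0] the claim inverts to
    a power of [t <= 2 * x], which costs the factor 2 to the [|a|]. *)
Lemma powR_shell a t x : 0 < t -> t / 2 <= x <= t ->
  x `^ a <= 2 `^ `|a| * t `^ a.
Proof.
move=> t0 /andP[tx xt].
have t20 : 0 < t / 2 by rewrite divr_gt0.
have x0 : 0 < x by apply: lt_le_trans tx.
have [a0|a0] := leP 0 a.
  apply: (@le_trans _ _ (t `^ a)).
    by rewrite ge0_ler_powR ?nnegrE// ltW.
  by rewrite ler_peMl ?powR_ge0// -[X in X <= _](powRr0 2) ler_powR ?ler1n ?normr_ge0.
rewrite ltr0_norm// -[a in leLHS]opprK -[a in t `^ a]opprK !(powRN _ (- a)).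
rewrite ler_pdivlMr ?powR_gt0// mulrC ler_pdivrMr ?powR_gt0// -powRM// ?(ltW x0)//.
have xge0 := ltW x0; rewrite ge0_ler_powR ?nnegrE ?oppr_ge0 ?mulr_ge0 ?(ltW t0) ?(ltW a0)//.
by rewrite mulrC -ler_pdivrMr.
Qed.

Lemma geometric_nneseries_lty c q : 0 <= c -> 0 < q -> q < 1 ->
  (\big[+%E/0%E]_(0 <= n <oo) (c * q ^+ n)%:E < +oo)%E.
Proof.
move=> c0 q0 q1.
apply: (@le_lt_trans _ _ (c / (1 - q))%:E); last exact: ltry.
apply: lime_le.
  by apply: is_cvg_nneseries => n _ _; rewrite lee_fin mulr_ge0// exprn_ge0// ltW.
apply: nearW => n; rewrite sumEFin lee_fin.
by apply: (geometric_le_lim n c0 q0); rewrite gtr0_norm.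
Qed.

End real_powers.

(** * Summation of an integral over dyadic shells *)

Section dyadic.
Context d (T : measurableType d) (R : realType).
Variables (m : {measure set T -> \bar R}) (F N : T -> R).
Hypotheses (mF : measurable_fun setT F) (mN : measurable_fun setT N).
Hypothesis F0 : forall z, 0 <= F z.

Lemma measurable_sublevel r : measurable [set z | N z <= r].
Proof.
rewrite (_ : [set z | _] = setT `&` N @^-1` `]-oo, r]%classic).
  by apply: mN.
by apply/seteqP; split => z /=; rewrite in_itv/=; tauto.
Qed.

(* With rho = 2 the shells exhaust {N >= 1}, with rho = 1/2 they exhaust
   {0 < N <= 1}. *)
Lemma dyadic_integral_lty (rho M a p : R) (D : set T) :
  measurable D -> 0 < rho ->
  (forall n, \int[m]_(z in [set z | (N z <= rho ^+ n)%R]) (F z)%:E <=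
             (M * (rho ^+ n) `^ p)%:E)%E ->
  rho `^ (p + a) < 1 ->
  (forall z, D z -> exists n, rho ^+ n / 2 <= N z <= rho ^+ n) ->
  (\int[m]_(z in D) (F z * N z `^ a)%:E < +oo)%E.
Proof.
move=> mD rho0 bound q1 cover.
have rhon0 n : 0 < rho ^+ n by rewrite exprn_gt0.
(* The bound at [n = 0] forces this, its left side being a nonnegative integral. *)
have M0 : 0 <= M.
  have := bound 0%N; rewrite [in leRHS]expr0 powR1 mulr1 -lee_fin.
  by apply: le_trans; apply: integral_ge0 => z _; rewrite lee_fin.
(* By [powR_shell], [c n] bounds the weight on the n-th shell. The majorant [h n] lives on the whole
   ball [B n], where [bound] applies directly. *)
pose c n := 2 `^ `|a| * (rho ^+ n) `^ a.
have c0 n : 0 <= c n by rewrite mulr_ge0 ?powR_ge0.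
pose B n := [set z | N z <= rho ^+ n].
pose h n z := (c n * (F \_ (B n)) z)%:E.
have FB0 n z : 0 <= (F \_ (B n)) z by rewrite patchE; case: ifP.
have h0 n z : (0 <= h n z)%E by rewrite lee_fin mulr_ge0.
have mFB n : measurable_fun setT (F \_ (B n)).
  by apply/(measurable_restrictT F (measurable_sublevel _)); exact: measurable_funTS.
have mh n : measurable_fun setT (h n).
  by apply/measurable_EFinP; apply: measurable_funM.
apply: (@le_lt_trans _ _
    (\int[m]_(z in D) \big[+%E/0%E]_(0 <= n <oo) h n z)%E).
  apply: ge0_le_integral => //.
  - by move=> z _; rewrite lee_fin mulr_ge0 ?powR_ge0.
  - apply/measurable_EFinP/measurable_funTS; apply: measurable_funM => //.
    exact: (measurableT_comp (measurable_powR a)).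
  - by apply: ge0_emeasurable_sum => // n _; exact: measurable_funTS.
  (* The term of one shell containing [z] already dominates the integrand, and the other terms are
     nonnegative. *)
  move=> z /cover[n /[dup] shell /andP[_ Nz]].
  apply: (@le_trans _ _ (h n z)).
    rewrite lee_fin patchE mem_set// mulrC ler_wpM2r//.
    exact: powR_shell.
  apply: le_trans (@nneseries_lim_ge _ (h ^~ z) xpredT 0%N n.+1 _) => //.
  by rewrite big_nat_recr//= leeDr// sume_ge0.
rewrite integral_nneseries//; last by move=> n; exact: measurable_funTS.
apply: (@le_lt_trans _ _ (\big[+%E/0%E]_(0 <= n <oo)
    (2 `^ `|a| * M * (rho `^ (p + a)) ^+ n)%:E)); last first.
  by apply: geometric_nneseries_lty; rewrite ?mulr_ge0 ?powR_ge0 ?powR_gt0.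
apply: lee_nneseries => [n _ _|n _]; first exact: integral_ge0.
apply: (@le_trans _ _ (\int[m]_z h n z)%E).
  exact: ge0_subset_integral.
under eq_integral do rewrite /h EFinM.
rewrite ge0_integralZl_EFin//; last 2 first.
- by move=> z _; rewrite lee_fin.
- exact/measurable_EFinP.
rewrite (_ : \int[m]_z _ = \int[m]_(z in B n) (F z)%:E)%E; last first.
  by rewrite [RHS]integral_mkcond; apply: eq_integral => z _; rewrite !patchE; case: ifP.
apply: (@le_trans _ _ ((c n)%:E * (M * (rho ^+ n) `^ p)%:E)%E).
  by apply: lee_wpmul2l; [rewrite lee_fin|exact: bound].
rewrite -EFinM lee_fin /c !powRXC ?(ltW rho0)//.
rewrite powRD ?(gt_eqF rho0) ?implybT// exprMn.
by rewrite le_eqVlt; apply/orP; left; apply/eqP; ring.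
Qed.

End dyadic.

(** * Real integrals: dependence on a parameter and bounds by the mass *)

Lemma measurable_parametric_Rintegral d1 d2 (T1 : measurableType d1)
    (T2 : measurableType d2) (R : realType)
    (mu : {sigma_finite_measure set T2 -> \bar R}) (f : T1 * T2 -> R) :
  measurable_fun setT f ->
  measurable_fun setT (fun z => \int[mu]_x f (z, x)).
Proof.
move=> mf; apply: (measurableT_comp (fine_measurable measurableT)).
under eq_fun do rewrite integralE.
have mEf : measurable_fun setT (EFin \o f) by exact/measurable_EFinP.
(* Tonelli applies to the positive and negative parts of the signed integrand separately. *)
apply: emeasurable_funB.
  apply: eq_measurable_fun (measurable_fun_fubini_tonelli_F (m2 := mu) _
    (measurable_funepos mEf) (funepos_ge0 _)) => z _.
  by apply: eq_integral => x _; rewrite /= !funeposE.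
apply: eq_measurable_fun (measurable_fun_fubini_tonelli_F (m2 := mu) _
  (measurable_funeneg mEf) (funeneg_ge0 _)) => z _.
by apply: eq_integral => x _; rewrite /= !funenegE.
Qed.

Lemma normr_Rintegral_le_mass d (T : measurableType d) (R : realType)
    (mu : {finite_measure set T -> \bar R}) (f : T -> R) :
  measurable_fun setT f -> (forall x, `|f x| <= 1) ->
  `|\int[mu]_x f x| <= fine (mu setT).
Proof.
move=> mf f1.
have muoo : mu setT \is a fin_num by exact: fin_num_measure.
have H : (`|\int[mu]_x (f x)%:E| <= mu setT)%E.
  have mEf : measurable_fun setT (EFin \o f) by exact/measurable_EFinP.
  apply: (le_trans (le_abse_integral _ _ mEf)) => //.
  rewrite -[leRHS]mul1e -(integral_cst _ measurableT).
  apply: ge0_le_integral => //.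
  - exact: measurableT_comp.
  - by move=> x _; rewrite lee_fin.
rewrite -fine_abse ?fine_le// ?abse_fin_num//; rewrite fin_num_abs;
by rewrite (le_lt_trans H)// ltey_eq muoo.
Qed.

(** * Measurability and boundedness of the Fourier transform; volume of balls *)

Section fourier.
Variables (R : realType) (d : nat).

Lemma measurable_dot : measurable_fun setT
  (fun p : euclid R d * euclid R d => dot p.1 p.2).
Proof.
apply: measurable_sum => i; apply: measurable_funM.
  exact: (measurableT_comp (measurable_tnth i) measurable_fst).
exact: (measurableT_comp (measurable_tnth i) measurable_snd).
Qed.

Lemma measurable_sqrt : measurable_fun setT (@Num.sqrt R).
Proof. exact: continuous_measurable_fun (@sqrt_continuous R). Qed.

Lemma measurable_enorm : measurable_fun setT (@enorm R d).
Proof.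
apply: (measurableT_comp measurable_sqrt).
have mid := @measurable_id _ (euclid R d) setT.
exact: (measurableT_comp measurable_dot (measurable_fun_pair mid mid)).
Qed.

Variable mu : {finite_measure set (euclid R d) -> \bar R}.

Lemma measurable_phase :
  measurable_fun setT
    (fun p : euclid R d * euclid R d => - (2 * pi * dot p.1 p.2)).
Proof.
apply: (measurableT_comp (@oppr_measurable R setT)) => //.
by apply: measurable_funM => //; exact: measurable_dot.
Qed.

Lemma measurable_fourier_norm : measurable_fun setT (fourier_norm mu).
Proof.
apply: (measurableT_comp measurable_sqrt).
apply: measurable_funD; apply: measurable_funX;
  apply: (@measurable_parametric_Rintegral _ _ _ _ _ mu
    (fun p => _ (- (2 * pi * dot p.1 p.2))));
  apply: measurableT_comp measurable_phase; apply: continuous_measurable_fun.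
- exact: continuous_cos.
- exact: continuous_sin.
Qed.

Lemma fourier_norm_ge0 z : 0 <= fourier_norm mu z.
Proof. exact: sqrtr_ge0. Qed.

(** The real and imaginary parts are each bounded by the mass [m], and
    [m ^+ 2 + m ^+ 2 <= (2 * m) ^+ 2]. The constant is crude, but only boundedness matters. *)
Lemma fourier_norm_le_mass z : fourier_norm mu z <= 2 * fine (mu setT).
Proof.
have marg : measurable_fun setT (fun x : euclid R d => - (2 * pi * dot z x)).
  exact: measurable_fun_pair2 measurable_phase.
have mass0 : 0 <= fine (mu setT) by apply: fine_ge0.
rewrite -[leRHS]ger0_norm ?mulr_ge0// -sqrtr_sqr ler_sqrt ?sqr_ge0//.
have sq t : `|t| <= fine (mu setT) -> t ^+ 2 <= fine (mu setT) ^+ 2.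
  by move=> ?; rewrite -real_normK ?num_real// lerXn2r ?nnegrE.
rewrite exprMn (@le_trans _ _ (fine (mu setT) ^+ 2 + fine (mu setT) ^+ 2))//.
  apply: lerD; apply/sq/normr_Rintegral_le_mass.
  - exact: (measurableT_comp (continuous_measurable_fun (@continuous_cos R)) marg).
  - by move=> x; exact: cos_max.
  - exact: (measurableT_comp (continuous_measurable_fun (@continuous_sin R)) marg).
  - by move=> x; exact: sin_max.
have := sqr_ge0 (fine (mu setT)); lra.
Qed.

Lemma normr_tnth_le_enorm (z : euclid R d) i : `|tnth z i : R| <= enorm z.
Proof.
rewrite -sqrtr_sqr ler_sqrt; last first.
  by apply: sumr_ge0 => j _; rewrite -expr2 sqr_ge0.
by rewrite /dot (bigD1 i)//= -expr2 lerDl sumr_ge0// => j _; rewrite -expr2 sqr_ge0.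
Qed.

Lemma measurable_box (A : 'I_d -> set (measurableTypeR R)) :
  (forall i, measurable (A i)) ->
  measurable [set z : euclid R d | forall i, A i (tnth z i)].
Proof.
move=> mA.
rewrite (_ : [set z | _] = \bigcap_(i in [set: 'I_d])
    ((@tnth _ (measurableTypeR R) ^~ i) @^-1` A i)).
  apply: fin_bigcap_measurable => // i _; rewrite -[X in measurable X]setTI.
  by apply: measurable_tnth => //; exact: mA.
by apply/seteqP; split=> z /= Az i => [_|]; exact: Az.
Qed.

(** The ball lies in the cube of side [2 * r], whose volume is a product. *)
Lemma lebesgue_ball_le (r : R) : 0 <= r ->
  (lebesgue R d [set z | (enorm z <= r)%R] <= ((2 * r) ^+ d)%:E)%E.
Proof.
move=> r0.
have mI : measurable (`[- r, r]%classic : set R) by exact: measurable_itv.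
pose I := fun _ : 'I_d => `[- r, r]%classic : set (measurableTypeR R).
apply: (@le_trans _ _ (lebesgue R d [set z | forall i, I i (tnth z i)])).
  apply: le_measure; rewrite ?inE.
  - exact: measurable_sublevel measurable_enorm r.
  - exact: measurable_box.
  move=> z /= zr i; rewrite /I/= in_itv/= -ler_norml.
  exact: le_trans (normr_tnth_le_enorm z i) zr.
rewrite lebesgue_box//= (_ : (2 * r) ^+ d = \prod_(i < d) (2 * r)); last first.
  by rewrite prodr_const card_ord.
rewrite -prodEFin (eq_bigr (fun=> (2 * r)%:E))// => i _.
rewrite lebesgue_measure_itv/= lte_fin.
(* If the test [- r < r] fails, then [r = 0] and both sides vanish. *)
case: ifPn => [_|]; first by rewrite -EFinB opprK mulr_natl mulr2n.
by rewrite -leNgt => rNr; congr EFin; lra.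
Qed.

Lemma fourier_ball_integral_le (p r : R) : 0 <= p -> 0 <= r ->
  (\int[lebesgue R d]_(z in [set z | (enorm z <= r)%R])
     (fourier_norm mu z `^ p)%:E <=
   ((2 * fine (mu setT)) `^ p * 2 ^+ d * r ^+ d)%:E)%E.
Proof.
move=> p0 r0.
have mB := measurable_sublevel measurable_enorm r.
apply: (@le_trans _ _
    (\int[lebesgue R d]_(z in [set z | (enorm z <= r)%R])
      (cst ((2 * fine (mu setT)) `^ p)%:E z))%E).
  apply: ge0_le_integral => //.
  - by move=> z _; rewrite lee_fin powR_ge0.
  - apply/measurable_EFinP/measurable_funTS.
    exact: (measurableT_comp (measurable_powR p) measurable_fourier_norm).
  move=> z _; rewrite lee_fin ge0_ler_powR ?nnegrE ?fourier_norm_ge0//.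
  - by rewrite mulr_ge0// fine_ge0.
  - exact: fourier_norm_le_mass.
rewrite integral_cst// -mulrA -exprMn EFinM.
by apply: lee_wpmul2l; [rewrite lee_fin powR_ge0|exact: lebesgue_ball_le].
Qed.

End fourier.

(** * From decay of ball integrals to finite energy *)

Section spectrum.
Variables (R : realType) (d : nat) (theta : R).
Variable mu : {finite_measure set (euclid R d) -> \bar R}.
Hypotheses (d0 : (0 < d)%N) (theta0 : 0 < theta).

Let ball_integral (r : R) : \bar R :=
  (\int[lebesgue R d]_(z in [set z | (enorm z <= r)%R])
     (fourier_norm mu z `^ (2 / theta))%:E)%E.

Let ball_integral_le (r : R) : 0 <= r -> exists2 i : R,
  ball_integral r = i%:E &
  0 <= i <= (2 * fine (mu setT)) `^ (2 / theta) * 2 ^+ d * r ^+ d.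
Proof.
move=> r0; have p0 : 0 <= 2 / theta by rewrite divr_ge0// ltW.
have := fourier_ball_integral_le mu p0 r0; rewrite -/(ball_integral r).
have : (0 <= ball_integral r)%E.
  by apply: integral_ge0 => z _; rewrite lee_fin powR_ge0.
by case: ball_integral => // i; rewrite !lee_fin => i0 ir; exists i => //; rewrite i0.
Qed.

Lemma ball_integral_decay (t : R) : (t%:E < lower_F mu theta)%E ->
  exists2 M : R, 0 <= M & forall r : R, 1 <= r ->
    (ball_integral r <= (M * r `^ (d%:R - t / theta))%:E)%E.
Proof.
rewrite /lower_F /limf_einf lteNr.
move=> /ereal_inf_lt[_ [V [r0 [_ r0V]] <-]] Vt.
(* The lower limit is minus an infimum of suprema over neighbourhoods of infinity; the strict
   inequality selects one, [V], containing all [r > r0]. *)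
have tV r : V r -> (t%:E < theta%:E * lne ((r ^- d)%:E * ball_integral r)
                           / (- ln r)%:E)%E.
  move=> Vr; rewrite -lteN2; apply: le_lt_trans Vt.
  by apply: ereal_sup_ubound; exists r.
have decay r : 1 < r -> r0 < r ->
    (ball_integral r <= (r `^ (d%:R - t / theta))%:E)%E.
  move=> r1 /r0V/tV; have rgt0 : 0 < r by exact: lt_trans r1.
  have [i -> /andP[ige0 _]] := ball_integral_le (ltW rgt0).
  have lnr : 0 < ln r by rewrite ln_gt0.
  have rd : 0 < r ^+ d by rewrite exprn_gt0.
  (* A vanishing ball integral, with logarithm [-oo], satisfies the bound trivially. *)
  rewrite -EFinM; have [i0|i0] := leP i 0.
    by move=> _; rewrite lee_fin (le_trans i0)// powR_ge0.
  have x0 : 0 < r ^- d * i by rewrite mulr_gt0// invr_gt0.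
  rewrite lne_EFin// inver oppr_eq0 gt_eqF// -!EFinM lte_fin lee_fin invrN mulrN.
  (* Since [ln r > 0], this isolates [ln (r ^- d * i) < - (t / theta) * ln r]. *)
  rewrite ltrNr ltr_pdivrMr// -ltr_pdivlMl// => lnx.
  rewrite powRD; last by rewrite (gt_eqF rgt0) implybT.
  rewrite powR_mulrn ?(ltW rgt0)// -ler_pdivrMl//.
  rewrite -ler_ln ?posrE ?powR_gt0// ln_powR (le_trans (ltW lnx))//.
  by rewrite le_eqVlt; apply/orP; left; apply/eqP; field; rewrite gt_eqF.
pose R1 := Num.max 1 r0.
pose C := (2 * fine (mu setT)) `^ (2 / theta) * 2 ^+ d.
have C0 : 0 <= C by rewrite mulr_ge0 ?powR_ge0.
have p0 : 0 <= R1 `^ `|t / theta| by exact: powR_ge0.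
(* The 1 serves [r > R1]. For [1 <= r <= R1] the trivial bound [C * r ^+ d] is used, the excess
   power [t / theta] of [r] being at most that of [R1]; the absolute value covers either sign of
   [t]. *)
exists (1 + C * R1 `^ `|t / theta|); first by rewrite addr_ge0// mulr_ge0.
move=> r r1; have rgt0 : 0 < r by exact: lt_le_trans r1.
have [rR|rR] := ltP R1 r.
  move: rR; rewrite gt_max => /andP[{}r1 /(decay _ r1)]/le_trans; apply.
  by rewrite lee_fin ler_peMl ?powR_ge0// lerDl mulr_ge0.
have [i -> /andP[_ /le_trans]] := ball_integral_le (ltW rgt0); rewrite lee_fin.
apply; rewrite -/C mulrDl mul1r ler_wpDl ?powR_ge0//.
rewrite -[in leRHS]mulrA ler_wpM2l// -powR_mulrn ?(ltW rgt0)//.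
rewrite [in leLHS](_ : d%:R = t / theta + (d%:R - t / theta)); last by ring.
rewrite powRD; last by rewrite (gt_eqF rgt0) implybT.
rewrite ler_wpM2r ?powR_ge0// (le_trans (ler_powR r1 (ler_norm _)))//.
by rewrite ge0_ler_powR ?nnegrE ?(ltW rgt0)// (le_trans ler01)// le_max lexx.
Qed.

(** Outside the unit ball [s < t] makes the shell series converge, inside it [0 < s] does; the
    origin is a null set. *)
Lemma energy_lty (s t : R) : 0 < s < t -> (t%:E < lower_F mu theta)%E ->
  (energy mu s theta < +oo)%E.
Proof.
move=> /andP[s0 st] /ball_integral_decay[M M0 decay].
have mF : measurable_fun setT (fun z => fourier_norm mu z `^ (2 / theta)).
  exact: (measurableT_comp (measurable_powR _) (measurable_fourier_norm mu)).
have F0 z : 0 <= fourier_norm mu z `^ (2 / theta) by exact: powR_ge0.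
pose a := s / theta - d%:R.
pose f (z : euclid R d) : \bar R :=
  (fourier_norm mu z `^ (2 / theta) * enorm z `^ a)%:E.
have f0 z : (0 <= f z)%E by rewrite lee_fin mulr_ge0 ?powR_ge0.
have mf D : measurable_fun D f.
  apply/measurable_EFinP/measurable_funTS; apply: measurable_funM => //.
  exact: (measurableT_comp (measurable_powR a) (@measurable_enorm R d)).
pose B r := [set z : euclid R d | enorm z <= r].
have mB r : measurable (B r) by exact: (measurable_sublevel (@measurable_enorm R d)).
rewrite /energy; apply: poweR_lty.
have ln2 : 0 < ln (2 : R) by rewrite ln_gt0// ltr1n.
have far : (\int[lebesgue R d]_(z in ~` B 1%R) f z < +oo)%E.
  apply: (@dyadic_integral_lty _ _ _ (lebesgue R d) _ _ mF (@measurable_enorm R d) F0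
      2 M a (d%:R - t / theta)) => //.
  - exact: measurableC.
  - by move=> n; apply: decay; rewrite exprn_ege1// ler1n.
  - apply: powR_lt1 => //; rewrite pmulr_llt0// /a.
    rewrite (_ : d%:R - t / theta + _ = (s - t) / theta); last by ring.
    by rewrite ltr_pdivrMr// mul0r subr_lt0.
  move=> z /negP; rewrite -ltNge => /ltW/dyadic_shell[n nz].
  (* Shells are indexed here by their outer radius, hence the shift. *)
  by exists n.+1; rewrite [X in X / 2]exprSr mulfK ?pnatr_eq0.
have near_origin : (\int[lebesgue R d]_(z in B 1%R `\` B 0%R) f z < +oo)%E.
  apply: (@dyadic_integral_lty _ _ _ (lebesgue R d) _ _ mF (@measurable_enorm R d) F0
      2^-1 ((2 * fine (mu setT)) `^ (2 / theta) * 2 ^+ d) a d%:R).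
  - exact: measurableD.
  - by rewrite invr_gt0.
  - move=> n; have r0 : 0 <= (2^-1 : R) ^+ n by rewrite exprn_ge0// invr_ge0.
    have [i Ii /andP[_ ile]] := ball_integral_le r0.
    by rewrite [leLHS]Ii lee_fin powR_mulrn.
  - apply: powR_lt1; first by rewrite invr_gt0.
    by rewrite lnV ?posrE// mulrN oppr_lt0 mulr_gt0// /a subrKC divr_gt0.
  move=> z [/= z1 /negP]; rewrite -ltNge => z0.
  (* Inversion turns shells shrinking to the origin into the growing ones. *)
  have /dyadic_shell[n /andP[nz zn]] : 1 <= (enorm z)^-1 by rewrite invf_ge1.
  exists n; rewrite exprVn -invfM -exprSr; apply/andP; split.
    by rewrite -[leRHS]invrK lef_pV2 ?posrE ?invr_gt0 ?exprn_gt0.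
  by rewrite -[leLHS]invrK lef_pV2 ?posrE ?invr_gt0 ?exprn_gt0.
(* The ball of radius 0 has volume at most [0 ^+ d], which is 0 because [0 < d]. *)
have at0 : (\int[lebesgue R d]_(z in B 0%R) f z = 0)%E.
  apply: null_set_integral => //; apply/eqP; rewrite eq_le measure_ge0 andbT.
  by apply: le_trans (lebesgue_ball_le d (lexx 0)) _; rewrite mulr0 expr0n gtn_eqF.
have -> : (\int[lebesgue R d]_z f z = \int[lebesgue R d]_(z in B 1%R `|` ~` B 1%R) f z)%E.
  by rewrite setUv.
rewrite ge0_integral_setU//; last 2 first.
- exact: measurableC.
- by rewrite disj_set2E setICr.
have -> : (\int[lebesgue R d]_(z in B 1%R) f z =
    \int[lebesgue R d]_(z in B 0%R `|` (B 1%R `\` B 0%R)) f z)%E.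
  by rewrite setDUK// => z /= /le_trans; apply.
rewrite ge0_integral_setU//; last 2 first.
- exact: measurableD.
- by rewrite disj_set2E setDIK.
by rewrite at0 add0e lte_add_pinfty.
Qed.

End spectrum.

Theorem theorem4p1 (R : realType) (d : nat)
    (mu : {finite_measure set (euclid R d) -> \bar R}) (theta : R) :
  (0 < d)%N -> (mu [set: euclid R d] != 0)%E -> 0 < theta <= 1 ->
  (lower_F mu theta <= fourier_dim mu theta)%E.
Proof.
move=> d0 _ /andP[theta0 _].
(* Two intermediate reals are needed: [s] above the dimension and [t] below [lower_F], with the gap
   that [energy_lty] requires. *)
have dense (x y : \bar R) : (0 <= x)%E -> (x < y)%E ->
    exists s t : R, [/\ (x < s%:E)%E, s < t & (t%:E < y)%E].
  case: x y => [x| |] [y| |]//= x0 xy.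
  - exists (x + (y - x) / 3), (x + (y - x) / 3 * 2).
    by move: xy; rewrite !lte_fin => xy; split; lra.
  - by exists (x + 1), (x + 2); rewrite lte_fin ltry; split=> //; lra.
rewrite leNgt; apply/negP => /dense[|s [t [dims st tF]]].
  by rewrite le_max lexx.
have s0 : 0 < s by move: dims; rewrite gt_max lte_fin => /andP[].
(* Finite energy at [s] puts [s] in the set of the supremum, contradicting [dims]. *)
have sdim : (s%:E <= fourier_dim mu theta)%E.
  rewrite le_max; apply/orP; right; apply: ereal_sup_ubound; exists s => //.
  split; first exact: ltW.
  by apply: energy_lty tF => //; rewrite s0.
by move: dims; rewrite ltNge sdim.
Qed.
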